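(* Let $G=(V,E)$ be the Soccer Ball Graph (SBG). There exist at least $26$ distinct Identifying Code Sets of $G$ of cardinality $10$.
   Context: For a finite undirected simple graph $G=(V,E)$ and $v\in V$, let $N(v)$ be the set of vertices adjacent to $v$ and $N^+(v)=\{v\}\cup N(v)$. A set $V'\subseteq V$ is an Identifying Code Set (ICS) of $G$ if $N^+(v)\cap V'\neq\varnothing$ for every $v\in V$, and $N^+(v)\cap V'\neq N^+(w)\cap V'$ for all $v,w\in V$ with $v\ne w$. Two ICSes are distinct if they are different as subsets of the labelled vertex set $V$ (symmetries of the graph are not factored out). The Soccer Ball Graph (SBG) has 32 vertices corresponding to the 20 hexagonal and 12 pentagonal faces of a truncated icosahedron, two vertices being adjacent iff the corresponding faces share a boundary edge (90 edges). Explicitly, $V=P\cup H$ with $P=\{P_{1,1}\}\cup\{P_{i,j}: i\in\{3,4\},1\le j\le5\}\cup\{P_{6,1}\}$ and $H=\{H_{i,j}: 2\le i\le 5, 1\le j\le 5\}$. Second indices $j$ (of the vertices with first index $2,\dots,5$) are taken modulo 5 with representatives $1,\dots,5$. The edges are, for all $1\le j\le5$: $\{P_{1,1},H_{2,j}\}$, $\{P_{6,1},H_{5,j}\}$, $\{H_{2,j},H_{2,j+1}\}$, $\{H_{5,j},H_{5,j+1}\}$, $\{H_{3,j},P_{3,j}\}$, $\{P_{3,j},H_{3,j+1}\}$, $\{H_{4,j},P_{4,j+1}\}$, $\{P_{4,j},H_{4,j}\}$, $\{H_{2,j},H_{3,j}\}$, $\{H_{2,j},P_{3,j-1}\}$,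 $\{H_{2,j},P_{3,j}\}$, $\{H_{3,j},P_{4,j}\}$, $\{H_{3,j},H_{4,j-1}\}$, $\{H_{3,j},H_{4,j}\}$, $\{P_{3,j},H_{4,j}\}$, $\{H_{4,j},H_{5,j}\}$, $\{P_{4,j},H_{5,j}\}$, $\{P_{4,j},H_{5,j-1}\}$. *)

(* Defs.v *)
From HB Require Import structures.
From mathcomp Require Import all_boot all_order all_algebra.

Set Implicit Arguments.
Unset Strict Implicit.
Unset Printing Implicit Defensive.

Import GRing.Theory.
Local Open Scope ring_scope.

(* A finite simple graph is a symmetric irreflexive relation on a finType. *)
Record sgraph := SGraph {
  svertex :> finType;
  sadj : rel svertex;
  sadj_sym : symmetric sadj;
  sadj_irr : irreflexive sadj
}.

Section IdentifyingCode.
Variable G : sgraph.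

Definition nbhd (v : G) : {set G} := [set u | sadj v u].

Definition closed_nbhd (v : G) : {set G} := v |: nbhd v.

Definition is_ICS (C : {set G}) : bool :=
  [forall v : G, closed_nbhd v :&: C != set0] &&
  [forall v : G, forall w : G,
     (v != w) ==> (closed_nbhd v :&: C != closed_nbhd w :&: C)].

End IdentifyingCode.

(* Vertices of the soccer ball graph: P = pentagonal, H = hexagonal faces.
   P11 and P61 are P_{1,1} and P_{6,1}; [P3 j] is P_{3,j}, and so on. The
   second index is a residue class modulo 5, so the representative 5 is 0. *)
Inductive sbg_vertex : Type :=
  | P11 | P61
  | P3 of 'Z_5 | P4 of 'Z_5
  | H2 of 'Z_5 | H3 of 'Z_5 | H4 of 'Z_5 | H5 of 'Z_5.

Definition sbg_code (v : sbg_vertex) :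
    bool + ('Z_5 + 'Z_5 + ('Z_5 + 'Z_5 + ('Z_5 + 'Z_5))) :=
  match v with
  | P11 => inl true
  | P61 => inl false
  | P3 j => inr (inl (inl j))
  | P4 j => inr (inl (inr j))
  | H2 j => inr (inr (inl (inl j)))
  | H3 j => inr (inr (inl (inr j)))
  | H4 j => inr (inr (inr (inl j)))
  | H5 j => inr (inr (inr (inr j)))
  end.

Definition sbg_decode
    (x : bool + ('Z_5 + 'Z_5 + ('Z_5 + 'Z_5 + ('Z_5 + 'Z_5)))) : sbg_vertex :=
  match x with
  | inl true => P11
  | inl false => P61
  | inr (inl (inl j)) => P3 j
  | inr (inl (inr j)) => P4 j
  | inr (inr (inl (inl j))) => H2 j
  | inr (inr (inl (inr j))) => H3 j
  | inr (inr (inr (inl j))) => H4 j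
  | inr (inr (inr (inr j))) => H5 j
  end.

Lemma sbg_codeK : cancel sbg_code sbg_decode.
Proof. by case. Qed.

HB.instance Definition _ := Finite.copy sbg_vertex (can_type sbg_codeK).

(* Each edge {u, v} is listed in one orientation, and the two edge families
   from H2 to P3 (likewise from H3 to H4 and from P4 to H5) share a case. *)
Definition sbg_arc (u v : sbg_vertex) : bool :=
  match u, v with
  | P11, H2 _ => true
  | P61, H5 _ => true
  | H2 j, H2 k => k == j + 1
  | H5 j, H5 k => k == j + 1
  | H3 j, P3 k => k == j
  | P3 j, H3 k => k == j + 1
  | H4 j, P4 k => k == j + 1
  | P4 j, H4 k => k == j
  | H2 j, H3 k => k == j
  | H2 j, P3 k => (k == j - 1) || (k == j)
  | H3 j, P4 k => k == j
  | H3 j, H4 k => (k == j - 1) || (k == j)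
  | P3 j, H4 k => k == j
  | H4 j, H5 k => k == j
  | P4 j, H5 k => (k == j) || (k == j - 1)
  | _, _ => false
  end.

Definition sbg_adj : rel sbg_vertex := fun u v => sbg_arc u v || sbg_arc v u.

Lemma sbg_adj_sym : symmetric sbg_adj.
Proof. by move=> u v; exact: orbC. Qed.

Lemma sbg_adj_irr : irreflexive sbg_adj.
Proof.
by case=> //= j; rewrite /sbg_adj /= orbb -{1}[j]addr0 (inj_eq (addrI j)).
Qed.

Definition SBG : sgraph := SGraph sbg_adj_sym sbg_adj_irr.

(* Main.v *)
Require Import Defs.
From mathcomp Require Import all_boot.
From mathcomp Require Import all_algebra.

(* The soccer ball graph has a rotational symmetry of order 5. The two rings H2
   and H5 form an identifying code invariant under it, and five more codes have
   free orbits, which makes 1 + 5 * 5 = 26. *)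

Set Implicit Arguments.
Unset Strict Implicit.
Unset Printing Implicit Defensive.

Section SeqCode.
Variable G : sgraph.

Definition covers (x v : G) : bool := (x == v) || sadj v x.

(** A version of [is_ICS] on explicit lists, which [vm_compute] can evaluate. Two traces on a code
    differ exactly when some code vertex covers one of [v], [w] but not the other. *)
Definition is_ICS_seq (vs s : seq G) : bool :=
  all (fun v => has (fun x => covers x v) s) vs &&
  all (fun v => all (fun w =>
    (v == w) || has (fun x => covers x v != covers x w) s) vs) vs.

Lemma in_closed_nbhd (v x : G) : (x \in closed_nbhd v) = covers x v.
Proof. by rewrite !inE. Qed.

Lemma is_ICS_seqW (vs s : seq G) :
  (forall v, v \in vs) -> is_ICS_seq vs s -> is_ICS [set x in s].
Proof.
move=> vsT /andP[/allP dom /allP sep]; apply/andP; split.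
  apply/forallP=> v; have /hasP[x xs xv] := dom v (vsT v).
  by apply/set0Pn; exists x; rewrite inE in_closed_nbhd xv inE.
apply/forallP=> v; apply/forallP=> w; apply/implyP=> /negPf neq_vw.
have /allP/(_ w (vsT w)) := sep v (vsT v).
(* Equal traces would agree at the separating code vertex [x]. *)
rewrite neq_vw => /hasP[x xs]; apply: contra => /eqP/setP/(_ x).
by rewrite ![in LHS]inE ![in RHS]inE xs !andbT /covers => ->.
Qed.

End SeqCode.

Definition residues : seq 'Z_5 := [:: 0; 1; 2; 3; 4]%R.

Definition sbg_vertices : seq SBG :=
  P11 :: P61 :: flatten [seq map h residues | h <- [:: P3; P4; H2; H3; H4; H5]].

Lemma mem_sbg_vertices (v : SBG) : v \in sbg_vertices.
Proof. by case: v => [||j|j|j|j|j|j] //; case: j => -[|[|[|[|[]]]]]. Qed.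

(** Rotation by [k] fifths of a turn about the axis through the opposite pentagons [P11] and
    [P61]. *)
Definition sbg_rot (k : 'Z_5) (v : SBG) : SBG :=
  match v with
  | P11 => P11 | P61 => P61
  | P3 j => P3 (j + k)%R | P4 j => P4 (j + k)%R
  | H2 j => H2 (j + k)%R | H3 j => H3 (j + k)%R
  | H4 j => H4 (j + k)%R | H5 j => H5 (j + k)%R
  end.

(* Found by exhaustive search. *)
Definition free_codes : seq (seq SBG) :=
  [:: [:: P61; H2 0; H2 3; H2 4; P3 1; H3 4; P4 0; P4 1; P4 2; P4 3];
      [:: P61; H2 1; P3 2; P3 3; P3 4; H3 1; P4 3; P4 4; H4 0; H4 1];
      [:: P11; P3 2; P3 3; H3 0; H3 1; P4 2; P4 3; P4 4; H4 0; H5 0];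
      [:: H2 3; H2 4; H3 1; H3 3; H3 4; H4 0; H4 1; H4 3; H5 0; H5 1];
      [:: P11; P3 0; P3 2; P3 3; P3 4; P4 4; H4 1; H5 0; H5 1; H5 2]]%R.

Definition sbg_codes : seq (seq SBG) :=
  (map H2 residues ++ map H5 residues) ::
  [seq map (sbg_rot k) s | s <- free_codes, k <- residues].

(** Each rotated code is tested directly, rather than deduced from the symmetry of the graph. *)
Lemma sbg_codes_ICS : all (is_ICS_seq sbg_vertices) sbg_codes.
Proof. by vm_compute. Qed.

Lemma sbg_codes_card : all (fun s => uniq s && (size s == 10)) sbg_codes.
Proof. by vm_compute. Qed.

(** Different lists could still enumerate the same set, so the codes are told apart by their
    characteristic vectors along [sbg_vertices]. *)
Lemma sbg_codes_sets_uniq : uniq [seq [set x in s] | s <- sbg_codes].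
Proof.
pose char (C : {set SBG}) := [seq v \in C | v <- sbg_vertices].
apply: (@map_uniq _ _ char); rewrite -map_comp.
(* Membership in the sets is traded for membership in the lists, which reduces by computation. *)
rewrite (@eq_map _ _ _ (fun s => [seq v \in s | v <- sbg_vertices])).
  by vm_compute.
by move=> s /=; apply: eq_map => v; rewrite inE.
Qed.

Theorem theorem2 :
  26 <= #|[set C : {set SBG} | is_ICS C & #|C| == 10]|.
Proof.
(* The bound is, by conversion, the length of the list of codes, so it suffices to include this
   duplicate-free list in the enumeration of all such codes. *)
rewrite cardE -[26]/(size [seq [set x in s] | s <- sbg_codes]).
apply: uniq_leq_size sbg_codes_sets_uniq _ => _ /mapP[s codes_s ->].
have /andP[/card_uniqP card_s size_s] := allP sbg_codes_card s codes_s.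
rewrite mem_enum inE cardsE card_s size_s andbT.
exact: is_ICS_seqW mem_sbg_vertices (allP sbg_codes_ICS s codes_s).
Qed.
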